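(* Let $p$ be a prime and let $G\le GL_d(p)=GL(V)$ be irreducible, $p$-exceptional and imprimitive, with $G=O^{p'}(G)$. Let $V=V_1\oplus\cdots\oplus V_n$ ($n>1$) be any decomposition of $V$ into nonzero subspaces permuted by $G$. Then the setwise stabiliser $G_{V_1}$ is transitive on $V_1^\sharp$, and the permutation group induced by $G$ on $\{V_1,\dots,V_n\}$ is a primitive $p$-concealed subgroup of $S_n$.
   Context: $V^\sharp$ denotes the set of nonzero vectors of $V$. $G\le GL_d(p)$ is $p$-exceptional if $p$ divides $|G|$ and every orbit of $G$ on $V=\mathbb{F}_p^d$ has size coprime to $p$. $K\le S_n$ is $p$-concealed if $p$ divides $|K|$ and every orbit of $K$ on the power set of $\{1,\dots,n\}$ has size coprime to $p$. $O^{p'}(G)$ is the smallest normal subgroup of $G$ of index coprime to $p$ (the subgroup generated by all $p$-elements). $G$ is imprimitive if it permutes the summands of some decomposition $V=V_1\oplus\cdots\oplus V_n$, $n>1$, into nonzero subspaces. *)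

(* Defs.v *)
From HB Require Import structures.
From mathcomp Require Import all_boot all_order all_algebra all_fingroup all_solvable all_field all_character.
Set Implicit Arguments. Unset Strict Implicit. Unset Printing Implicit Defensive.
Import GRing.Theory.
Local Open Scope ring_scope.

(* V = 'rV['F_p]_d.+1 (row vectors), GL_{d+1}(p) = {'GL_d.+1('F_p)} acting on the
   right: v |-> v *m g.  The natural representation of a subgroup G. *)
Definition natrepr (p d : nat) (G : {group {'GL_d.+1['F_p]}}) :
  mx_representation 'F_p G d.+1 :=
  subg_repr (GLrepr 'F_p d) (subsetT G).

(* G is irreducible on V *)
Definition irreducible_lin (p d : nat) (G : {group {'GL_d.+1['F_p]}}) : Prop :=
  mx_irreducible (natrepr G).

(* G is p-exceptional: p divides |G| and every G-orbit on V has size coprime to p *)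
Definition p_exceptional (p d : nat) (G : {group {'GL_d.+1['F_p]}}) : bool :=
  (p %| #|G|)%N &&
  [forall v : 'rV['F_p]_d.+1, coprime p #|orbit ('MR (natrepr G)) G v|].

(* O^{p'}(G): the subgroup generated by all p-elements of G *)
Definition Opprime_res (p : nat) (gT : finGroupType) (G : {set gT}) : {set gT} :=
  <<[set x in G | p.-elt x]>>%g.

(* Vs : 'I_n -> subspaces (row spaces of square matrices) gives a decomposition
   V = Vs 0 (+) ... (+) Vs (n-1), n > 1, into nonzero subspaces permuted by G. *)
Definition permuted_decomposition (p d : nat) (G : {group {'GL_d.+1['F_p]}})
    (n : nat) (Vs : 'I_n -> 'M['F_p]_d.+1) : Prop :=
  [/\ (1 < n)%N,
      forall i, Vs i != 0,
      mxdirect (\sum_i Vs i)%MS,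
      (\sum_i Vs i == 1%:M)%MS &
      forall g, g \in G -> forall i, exists j, (Vs i *m GLval g == Vs j)%MS].

(* G is imprimitive *)
Definition imprimitive_lin (p d : nat) (G : {group {'GL_d.+1['F_p]}}) : Prop :=
  exists n (Vs : 'I_n -> 'M['F_p]_d.+1), permuted_decomposition G Vs.

(* The setwise stabiliser G_{V_i} *)
Definition subspace_stab (p d : nat) (G : {group {'GL_d.+1['F_p]}})
    (U : 'M['F_p]_d.+1) : {set {'GL_d.+1['F_p]}} :=
  [set g in G | (U *m GLval g == U)%MS].

(* U^# : nonzero vectors of U *)
Definition nonzero_vecs (p d : nat) (U : 'M['F_p]_d.+1) : {set 'rV['F_p]_d.+1} :=
  [set v : 'rV['F_p]_d.+1 | (v <= U)%MS && (v != 0)].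

(* The permutation group induced by G on {Vs i}: all permutations s of 'I_n
   realised by some g in G (V_i g = V_{s i}). *)
Definition induced_perm_group (p d : nat) (G : {group {'GL_d.+1['F_p]}})
    (n : nat) (Vs : 'I_n -> 'M['F_p]_d.+1) : {set {perm 'I_n}} :=
  [set s : {perm 'I_n} |
     [exists g in G, [forall i, (Vs i *m GLval g == Vs (s i))%MS]]].

(* K <= S_n is p-concealed *)
Definition p_concealed (p n : nat) (K : {set {perm 'I_n}}) : bool :=
  (p %| #|K|)%N &&
  [forall A : {set 'I_n}, coprime p #|orbit ('P^*)%act K A|].

(* Main.v *)
(** If a p-element u moves a point i of S, let B be the orbit of i under <u>,
    so that |B| is a multiple of p.  Colour i with 1, the rest of B with 2 and
    everything else with 0.  The stabiliser N of B is transitive on B, while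
    every element fixing the colouring lies in the stabiliser of i in N; hence
    the orbit of the colouring has size divisible by |N : N_i| = |B|, and so by
    p.  Therefore a group generated by its p-elements acts trivially on S as
    soon as its orbits on 3-colourings of S, or on any objects inducing these
    colourings equivariantly, have size coprime to p.

    If the stabiliser of V_1 had two orbits on the nonzero vectors of V_1,
    vectors of V would induce all 3-colourings of {V_1, ..., V_n}: a component
    is zero, in the G-orbit of a fixed vector, or neither.  If the group induced
    on {1, ..., n} had a nontrivial block system, subsets would induce these
    3-colourings of the blocks: a block meets the subset in 0, 1 or at least 2
    points.  Supports of vectors give p-concealment. *)
Require Import Defs.
From HB Require Import structures.
From mathcomp Require Import all_boot all_order all_algebra all_fingroup all_solvable all_field all_character.
Set Implicit Arguments. Unset Strict Implicit. Unset Printing Implicit Defensive.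
Import GRing.Theory.

(** * The 3-colouring criterion for a trivial action *)

Section Colouring.
Local Open Scope group_scope.

(** [T] is kept abstract so that its elements can be subsets as well as vectors. The two actions
    have their own domains because a representation of [G] acts only on [G]. *)
Lemma pelt_gen_astab_of_colouring (aT : finGroupType) (p : nat)
    (D1 D2 G : {group aT}) (T I : finType) (to : action D1 T)
    (to2 : action D2 I) (S : {set I}) (col : T -> I -> nat) :
    prime p -> G \subset D1 -> [acts G, on S | to2] ->
    Opprime_res p G = G ->
    (forall x, coprime p #|orbit to G x|) ->
    (forall x g i, g \in G -> i \in S -> col (to x g) (to2 i g) = col x i) ->
    (forall (B : {set I}) i, B \subset S -> i \in B ->
       exists x, forall j, j \in S ->
         col x j = (if j == i then 1 else if j \in B then 2 else 0)%N) ->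
  G \subset 'C(S | to2).
Proof.
move=> p_pr sGD1 actS genG cop colG ex_col.
have sGD2 := acts_dom actS.
rewrite -{1}genG gen_subG; apply/subsetP => u /setIdP[Gu pu].
rewrite inE (subsetP sGD2) //= inE; apply/subsetP => i Si; rewrite inE.
have sUG : <[u]> \subset G by rewrite cycle_subG.
have sUD2 := subset_trans sUG sGD2.
pose B := orbit to2 <[u]> i.
have Bi : i \in B by exact: orbit_refl.
have sBS : B \subset S.
  apply/subsetP => _ /orbitP[a Ua <-].
  by rewrite (acts_act actS) // (subsetP sUG).
have pB : p.-nat #|B|.
  by rewrite card_orbit_in //; apply: pnat_dvd (dvdn_indexg _ _) _; exact: pu.
have [/eqP/card_orbit1 B1 | B_neq1] := boolP (#|B| == 1%N).
  have: to2 i u \in B by apply: mem_orbit; exact: cycle_id.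
  by rewrite /B B1 inE.
have dvdpB : p %| #|B|.
  have [k oB] := p_natP pB; rewrite oB in B_neq1 *.
  by case: k {oB} B_neq1 => // k _; rewrite expnS dvdn_mulr.
have [x colx] := ex_col _ _ sBS Bi.
pose N := 'N_G(B | to2); pose M := 'C_N[i | to2].
(* [<[u]>] preserves its own orbit [B], so it lies in [N] and already makes [N] transitive on
   [B]. *)
have defB : orbit to2 N i = B.
  apply/eqP; rewrite eqEsubset; apply/andP.
  split; apply/subsetP => _ /orbitP[a Ha <-].
    by have /setIP[_ nBa] := Ha; rewrite astabs_act.
  have Da := subsetP sUD2 _ Ha.
  apply: mem_orbit; rewrite inE (subsetP sUG) //= inE Da inE.
  apply/subsetP => _ /orbitP[b Ub <-]; rewrite inE.
  by rewrite -actMin ?(subsetP sUD2) // mem_orbit ?groupM.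
(* An element fixing [x] preserves colours on [S]. There [B] is the set of points of nonzero colour,
   and [i] is the only point of colour 1. *)
have sCM : 'C_G[x | to] \subset M.
  apply/subsetP => a /setIP[Ga Cxa].
  have xa : to x a = x by apply: astab_act Cxa (set11 x).
  have Da := subsetP sGD2 _ Ga.
  have colxa j : j \in S -> col x (to2 j a) = col x j.
    by move=> Sj; rewrite -[in LHS]xa colG.
  have Sa j : j \in S -> to2 j a \in S by move=> Sj; rewrite (acts_act actS).
  rewrite !inE Ga Da /= sub1set inE; apply/andP; split.
    apply/subsetP => j Bj; have Sj := subsetP sBS _ Bj; rewrite inE.
    have := colxa j Sj; rewrite !colx ?Sa // Bj.
    by case: (_ =P i) => [-> // | _]; case: ifP => // _; case: ifP.
  have := colxa i Si; rewrite !colx ?Sa // eqxx.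
  by case: (_ =P i) => // _; case: ifP.
have sNG : N \subset G := subsetIl _ _.
have sMN : M \subset N := subsetIl _ _.
have: p %| #|orbit to G x|.
  (* The index of the stabiliser of [x] factors along [G], [N], [M], and the middle factor |N : M|
     is |B|. *)
  rewrite card_orbit_in // -(Lagrange_index (subset_trans sMN sNG) sCM).
  rewrite -(Lagrange_index sNG sMN) -card_orbit_in ?(subset_trans sNG) // defB.
  by rewrite dvdn_mulr // dvdn_mull.
by move=> dvd; have := cop x; rewrite prime_coprime // dvd.
Qed.

End Colouring.

(** * Groups generated by p-elements, and primitivity *)

Section Restriction.
Local Open Scope group_scope.

Lemma Opprime_res_morphim (p : nat) (aT rT : finGroupType) (D G : {group aT})
    (f : {morphism D >-> rT}) :
  G \subset D -> Opprime_res p G = G -> Opprime_res p (f @* G) = f @* G.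
Proof.
move=> sGD genG; apply/eqP; rewrite eqEsubset; apply/andP; split.
  by rewrite gen_subG; apply/subsetP => x /setIdP[].
have sXD : [set x in G | p.-elt x] \subset D.
  by apply: subset_trans sGD; apply/subsetP => x /setIdP[].
rewrite -{1}genG morphim_gen // genS //.
apply/subsetP => _ /morphimP[x Dx /setIdP[Gx px] ->].
by rewrite inE mem_morphim //= morph_p_elt.
Qed.

Lemma dvdn_card_Opprime_res (p : nat) (gT : finGroupType) (G : {group gT}) :
  prime p -> Opprime_res p G = G -> G :!=: 1 -> p %| #|G|.
Proof.
move=> p_pr genG; apply: contraR => ndvd.
rewrite -subG1 -{1}genG gen_subG; apply/subsetP => x /setIdP[Gx px].
rewrite inE -order_eq1 -[#[x]](part_pnat_id px) p_part_eq1.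
apply: contra ndvd; rewrite mem_primes => /and3P[_ _ dvd].
exact: dvdn_trans dvd (order_dvdG Gx).
Qed.

Lemma primitive_of_coprime_orbits (p : nat) (aT : finGroupType)
    (sT : finType) (to : {action aT &-> sT}) (G : {group aT}) (S : {set sT}) :
    prime p -> Opprime_res p G = G -> [transitive G, on S | to] ->
    (forall A : {set sT}, coprime p #|orbit (to^*)%act G A|) ->
  [primitive G, on S | to].
Proof.
move=> p_pr genG trG cop; rewrite /primitive trG /=.
apply/existsP => -[Q /and3P[/[dup] partQ /and3P[/eqP covQ tiQ nQ0] actQ]].
move=> /andP[Q_gt1 ltQS].
have memQ B x : B \in Q -> x \in B -> x \in S.
  by move=> QB Bx; rewrite -covQ; apply/bigcupP; exists B.
have uniqQ B C x : B \in Q -> C \in Q -> x \in B -> x \in C -> B = C.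
  by move=> QB QC Bx Cx; rewrite -(def_pblock tiQ QB Bx) (def_pblock tiQ QC Cx).
have inhQ B : B \in Q -> exists x, x \in B.
  by move=> QB; apply/set0Pn/(partition_neq0 partQ).
have trQ B C : B \in Q -> C \in Q -> exists2 g, g \in G & to^* B g = C.
  move=> QB QC; have [[x Bx] [y Cy]] := (inhQ B QB, inhQ C QC).
  have [g Gg yE] := atransP2 trG (memQ _ _ QB Bx) (memQ _ _ QC Cy).
  exists g => //; apply: (uniqQ _ _ y) => //.
    by rewrite (acts_act actQ).
  by rewrite yE mem_setact.
(* Blocks are conjugate, so one block of size at most 1 would force |S| <= |Q|. Size at least 2 is
   what makes colour 2 available on every block. *)
have big B : B \in Q -> 1 < #|B|.
  move=> QB; rewrite ltnNge; apply/negP => B1.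
  move: ltQS; rewrite (card_partition partQ) ltnNge -sum1_card leq_sum // => C QC.
  by have [g _ <-] := trQ _ _ QB QC; rewrite card_setact.
pose col (A B : {set sT}) := minn 2 #|A :&: B|.
have sGC : G \subset 'C(Q | to^*).
  apply: (pelt_gen_astab_of_colouring (to := (to^*)%act) (col := col)) cop _ _
    => //; first exact: subsetT.
  - move=> A g B _ _; rewrite /col /= /setact -imsetI ?card_imset //.
      exact: act_inj.
    by move=> x y _ _; exact: act_inj.
  move=> W B0 sWQ WB0; have QB0 := subsetP sWQ _ WB0.
  have [x0 B0x0] := inhQ _ QB0.
  (* One point of [B0], all of every other block in [W], and nothing else: the traces on blocks have
     size 1, at least 2, and 0. *)
  exists (x0 |: cover (W :\ B0)) => B QB; rewrite /col.
  have covP x : x \in B -> (x \in cover (W :\ B0)) = (B \in W :\ B0).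
    move=> Bx; apply/bigcupP/idP => [[C WC Cx] | WB]; last by exists B.
    by have [_ WC'] := setD1P WC; rewrite (uniqQ B C x) // (subsetP sWQ).
  case: eqP => [-> | /eqP B_neq].
    rewrite (_ : _ :&: _ = [set x0]) ?cards1 //.
    apply/setP => x; rewrite !inE; case: eqP => [-> | _] /=; first by rewrite B0x0.
    apply/negP => /andP[+ B0x]; rewrite /cover => /bigcupP[C /setD1P[C_neq WC] Cx].
    by rewrite (uniqQ C B0 x) ?(subsetP sWQ) // eqxx in C_neq.
  have x0B : x0 \notin B.
    by apply: contra B_neq => Bx0; rewrite (uniqQ B B0 x0).
  case: ifP => WB.
    rewrite (_ : _ :&: _ = B); first by apply/minn_idPl/big.
    apply/setP => x; rewrite !inE; have [Bx | _] := boolP (x \in B); last by rewrite andbF.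
    by rewrite covP // !inE B_neq WB orbT.
  rewrite (_ : _ :&: _ = set0) ?cards0 //.
  apply/setP => x; rewrite !inE; have [Bx | _] := boolP (x \in B); last by rewrite andbF.
  rewrite covP // !inE WB andbF orbF andbT; apply: contraNF x0B => /eqP <-; exact: Bx.
have [B QB] : exists B, B \in Q by apply/set0Pn; rewrite -card_gt0 ltnW.
(* [G] fixes every block but also permutes the blocks transitively, so there is only one. *)
have /cards1P[C defQ] : #|Q| == 1%N.
  apply/cards1P; exists B; apply/setP => C; rewrite inE.
  apply/idP/eqP => [QC | -> //]; have [g Gg <-] := trQ _ _ QB QC.
  by rewrite (astab_act (subsetP sGC _ Gg)).
by rewrite defQ cards1 in Q_gt1.
Qed.

End Restriction.

(** * The action on summands and on components of vectors *)

Section Decomposition.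
Local Open Scope ring_scope.

Variables (p d : nat) (G : {group {'GL_d.+1['F_p]}}).
Variables (n : nat) (Vs : 'I_n -> 'M['F_p]_d.+1).
Hypothesis decV : permuted_decomposition G Vs.

Lemma GLvalK m (A : 'M['F_p]_(m, d.+1)) (g : {'GL_d.+1['F_p]}) :
  A *m GLval g *m GLval g^-1%g = A.
Proof. by rewrite GL_VxE mulmxK //; exact: GL_unit g. Qed.

Lemma GLval_mul_eq0 m (A : 'M['F_p]_(m, d.+1)) (g : {'GL_d.+1['F_p]}) :
  (A *m GLval g == 0) = (A == 0).
Proof.
by apply/eqP/eqP => [Ag0 | ->]; [rewrite -(GLvalK A g) Ag0 | ]; rewrite mul0mx.
Qed.

Lemma decomp_cap j : (Vs j :&: \sum_(k | k != j) Vs k)%MS = 0.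
Proof. by case: decV => _ _ /mxdirect_sumsP/(_ j isT). Qed.

Lemma decomp_eq j k (v : 'rV['F_p]_d.+1) :
  v != 0 -> (v <= Vs j)%MS -> (v <= Vs k)%MS -> j = k.
Proof.
move=> v0 vj vk; apply/eqP; apply: contraNT v0 => jk.
rewrite -submx0 -(decomp_cap j) sub_capmx vj /=.
by apply: submx_trans vk _; rewrite (sumsmx_sup k) // eq_sym.
Qed.

Lemma decomp_inj j k : (Vs j <= Vs k)%MS -> j = k.
Proof.
have [_ V0 _ _ _] := decV => sV.
apply: (@decomp_eq _ _ (nz_row (Vs j))); rewrite ?nz_row_eq0 ?nz_row_sub //.
by apply: submx_trans sV; exact: nz_row_sub.
Qed.

(** The default 1 is taken only when [g] does not permute the summands, which never happens for [g]
    in [G]. *)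
Definition decomp_perm (g : {'GL_d.+1['F_p]}) : 'S_n :=
  odflt 1%g [pick s : 'S_n | [forall j, (Vs j *m GLval g == Vs (s j))%MS]].

Lemma decomp_permP g :
  g \in G -> forall j, (Vs j *m GLval g :=: Vs (decomp_perm g j))%MS.
Proof.
move=> Gg; suff: [forall j, (Vs j *m GLval g == Vs (decomp_perm g j))%MS].
  by move=> /forallP Vg j; apply/eqmxP.
rewrite /decomp_perm; case: pickP => //= noperm.
have [_ _ _ _ /(_ g Gg) exV] := decV.
pose f j := xchoose (exV j).
have fP j : (Vs j *m GLval g == Vs (f j))%MS := xchooseP (exV j).
have f_inj : injective f.
  move=> j k jk; apply: decomp_inj; rewrite -(GLvalK (Vs j) g) -(GLvalK (Vs k) g).
  by apply: submxMr; rewrite (eqmxP (fP j)) jk (eqmxP (fP k)).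
have /negP[] := noperm (perm f_inj).
by apply/forallP => j; rewrite permE.
Qed.

Lemma decomp_perm_uniq g (s : 'S_n) : g \in G ->
  (forall j, (Vs j *m GLval g <= Vs (s j))%MS) -> decomp_perm g = s.
Proof.
move=> Gg Vg; apply/permP => j; apply: decomp_inj.
by rewrite -(decomp_permP Gg).
Qed.

Lemma decomp_permM : {in G &, {morph decomp_perm : g h / (g * h)%g}}.
Proof.
move=> g h Gg Gh; apply: decomp_perm_uniq => [|j]; first exact: groupM.
rewrite permM GL_MxE mulmxA -(decomp_permP Gh); apply: submxMr.
by rewrite (decomp_permP Gg).
Qed.

Canonical decomp_perm_morphism := Morphism decomp_permM.

Lemma induced_perm_groupE :
  induced_perm_group G Vs = (decomp_perm_morphism @* G)%g.
Proof.
apply/setP => s; rewrite inE; apply/existsP/morphimP.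
  case=> g /andP[Gg /forallP Vg]; exists g => //; apply/esym/decomp_perm_uniq => // j.
  by rewrite (eqmxP (Vg j)).
case=> g _ Gg ->; exists g; rewrite Gg /=; apply/forallP => j.
exact/eqmxP/decomp_permP.
Qed.

Definition component j (v : 'rV['F_p]_d.+1) : 'rV['F_p]_d.+1 :=
  v *m proj_mx (Vs j) (\sum_(k | k != j) Vs k)%MS.

Lemma component_sum (u : 'I_n -> 'rV['F_p]_d.+1) j :
  (forall k, u k <= Vs k)%MS -> component j (\sum_k u k) = u j.
Proof.
move=> uV; rewrite /component (bigD1 j) //= mulmxDl.
rewrite proj_mx_id ?decomp_cap // proj_mx_0 ?decomp_cap ?addr0 //.
by apply: summx_sub_sums => k _.
Qed.

Lemma component_sub j v : (component j v <= Vs j)%MS.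
Proof. exact: proj_mx_sub. Qed.

Lemma sum_component v : \sum_j component j v = v.
Proof.
have [_ _ _ /andP[_ sV] _] := decV.
have /sub_sumsmxP[u ->] := submx_trans (submx1 v) sV.
by apply: eq_bigr => j _; apply: component_sum => k; exact: submxMl.
Qed.

(** The images under [g] of the components of [v] lie in the permuted summands and add up to the
    image of [v]; components are unique. *)
Lemma component_act g v j : g \in G ->
  component (decomp_perm g j) (v *m GLval g) = component j v *m GLval g.
Proof.
move=> Gg; rewrite -[in LHS](sum_component v) mulmx_suml.
rewrite (reindex_inj (@perm_inj _ (decomp_perm g)^-1%g)) /=.
rewrite component_sum ?permK // => k.
by rewrite -[k in Vs k](permKV (decomp_perm g)) -decomp_permP // submxMr ?component_sub.
Qed.

Lemma natrepr_actE g v : g \in G -> ('MR (natrepr G))%act v g = v *m GLval g.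
Proof. exact: mx_repr_actE. Qed.

(** * Consequences of irreducibility and p-exceptionality *)

Hypothesis irrG : irreducible_lin G.

(** The summands in one orbit span a nonzero submodule, hence all of V; a summand outside the orbit
    would then lie in the sum of the others. *)
Lemma decomp_perm_trans j k : exists2 g, g \in G & decomp_perm g j = k.
Proof.
have [_ V0 _ _ _] := decV.
pose O := [set decomp_perm g j | g in G].
suff /imsetP[g Gg ->] : k \in O by exists g.
pose U := (\sum_(l in O) Vs l)%MS.
have modU : mxmodule (natrepr G) U.
  apply/mxmoduleP => g Gg; rewrite sumsmxMr.
  apply/sumsmx_subP => _ /imsetP[h Gh ->].
  rewrite (decomp_permP Gg) -permM -decomp_permM // (sumsmx_sup _ _ (submx_refl _)) //.
  by apply: imset_f; exact: groupM.
have nzU : U != 0.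
  have jO : j \in O.
    by apply/imsetP; exists 1%g => //; rewrite (morph1 decomp_perm_morphism) perm1.
  apply: contraNneq (V0 j) => U0; rewrite -submx0 -U0.
  exact: sumsmx_sup jO (submx_refl _).
have [_ _ /(_ U modU (submx1 U) nzU) fullU] := irrG.
apply: contraR (V0 k) => kO; rewrite -submx0 -(decomp_cap k) sub_capmx submx_refl /=.
apply: submx_trans (submx1 _) (submx_trans fullU _).
apply/sumsmx_subP => l lO; rewrite (sumsmx_sup l) //.
by apply: contraNneq kO => <-.
Qed.

Hypotheses (p_pr : prime p) (excG : p_exceptional G).

Lemma coprime_orbit_vec v : coprime p #|orbit ('MR (natrepr G)) G v|.
Proof. by case/andP: excG => _ /forallP. Qed.

(** Take [v] with support [A]. The stabiliser of [v] in [G] also fixes [A], so the orbit size of [A]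
    divides that of [v]. *)
Lemma coprime_orbit_subset (A : {set 'I_n}) :
  coprime p #|orbit ('P^*)%act (decomp_perm_morphism @* G)%g A|.
Proof.
have [_ V0 _ _ _] := decV.
pose v := \sum_j (if j \in A then nz_row (Vs j) else 0).
have suppv j : (component j v != 0) = (j \in A).
  rewrite component_sum => [|k]; last by case: ifP; rewrite ?sub0mx ?nz_row_sub.
  by case: ifP => _; rewrite ?eqxx ?nz_row_eq0 ?V0.
pose to := (('P^*) \o decomp_perm_morphism)%act.
have sGD : G \subset (decomp_perm_morphism @*^-1 setT)%g.
  by apply/subsetP => g Gg; rewrite !inE Gg.
have -> : orbit ('P^*)%act (decomp_perm_morphism @* G)%g A = orbit to G A.
  apply/setP => B; apply/orbitP/orbitP.
    by case=> _ /morphimP[g _ Gg ->] <-; exists g.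
  by case=> g Gg <-; exists (decomp_perm g); rewrite // mem_morphim.
apply: coprime_dvdr (coprime_orbit_vec v).
rewrite !card_orbit_in //; apply: indexgS; apply/subsetP => g /setIP[Gg Cv].
have vg : v *m GLval g = v.
  by rewrite -natrepr_actE //; apply: astab_act Cv (set11 v).
rewrite !inE Gg /= sub1set inE; apply/eqP.
apply/setP => j; rewrite -[j](permKV (decomp_perm g)).
rewrite -[in RHS]suppv -[in RHS]vg component_act // GLval_mul_eq0 suppv.
by rewrite /= /comp_act /= mem_imset //; exact: act_inj.
Qed.

Hypothesis genG : Opprime_res p G = G.

Lemma subspace_stab_trans i :
  [transitive subspace_stab G (Vs i), on nonzero_vecs (Vs i) | 'MR (natrepr G)].
Proof.
have [n_gt1 V0 _ _ _] := decV.
pose a := nz_row (Vs i).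
have a0 : a != 0 by rewrite nz_row_eq0.
have aV : (a <= Vs i)%MS by exact: nz_row_sub.
(* The orbit is taken under all of [G], so that colours are [G]-invariant. Inside [Vs i] nothing is
   gained: an element sending [a] to a vector of [Vs i] must stabilise [Vs i], since distinct
   summands share no nonzero vector. *)
pose orb (w : 'rV['F_p]_d.+1) := [exists g in G, w == a *m GLval g].
have orb_stab w : (w <= Vs i)%MS -> orb w ->
    w \in orbit ('MR (natrepr G)) (subspace_stab G (Vs i)) a.
  move=> wV /existsP[g /andP[Gg /eqP wE]]; apply/orbitP; exists g; last first.
    by rewrite natrepr_actE.
  rewrite inE Gg; have := decomp_permP Gg i.
  rewrite (@decomp_eq (decomp_perm g i) i w) // => [/eqmxP // | |].
    by rewrite wE GLval_mul_eq0.
  by rewrite wE -decomp_permP // submxMr.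
have orbM w g : g \in G -> orb (w *m GLval g) = orb w.
  move=> Gg; apply/existsP/existsP => -[h /andP[Gh /eqP wE]].
    exists (h * g^-1)%g; apply/andP; split; first by rewrite groupM ?groupV.
    by apply/eqP; rewrite GL_MxE mulmxA -wE GLvalK.
  exists (h * g)%g; apply/andP; split; first by rewrite groupM.
  by apply/eqP; rewrite wE GL_MxE mulmxA.
have orb_a : orb a by apply/existsP; exists 1%g; rewrite group1 GL_1E mulmx1 eqxx.
apply/imsetP; exists a; first by rewrite inE aV.
apply/eqP; rewrite eqEsubset; apply/andP; split; last first.
  apply/subsetP => _ /orbitP[g /setIdP[Gg Vg] <-].
  by rewrite natrepr_actE // inE GLval_mul_eq0 a0 andbT -(eqmxP Vg) submxMr.
apply/subsetP => b /setIdP[bV b0]; apply: orb_stab => //.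
(* If [b] is outside the orbit of [a], all 3-colourings of the summands occur; this will force
   [n <= 1]. *)
apply: contraLR (n_gt1) => Nb; rewrite -leqNgt.
pose col v j : nat :=
  if component j v == 0 then 0%N else if orb (component j v) then 1%N else 2.
pose to2 := ('P \o decomp_perm_morphism)%act.
have fixG : G \subset ('C([set: 'I_n] | to2))%g.
  apply: (@pelt_gen_astab_of_colouring _ _ _ _ _ _ _
            ('MR (natrepr G))%act to2 setT col p_pr (subxx _) _ genG
            coprime_orbit_vec).
  - by apply/subsetP => g Gg; rewrite !inE Gg; apply/subsetP => j _; rewrite !inE.
  - move=> v g j Gg _; have cE := component_act v j Gg.
    by rewrite /col (natrepr_actE _ Gg) cE GLval_mul_eq0 (orbM _ _ Gg).
  move=> B j0 _ Bj0.
  (* Elements [t j] of [G] carry copies of [a] and [b] from [Vs i] into each [Vs j] without changing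
     their colours. *)
  have ex_t j : exists g, (g \in G) && (decomp_perm g i == j).
    by have [g Gg <-] := decomp_perm_trans i j; exists g; rewrite Gg eqxx.
  pose t j := xchoose (ex_t j).
  have tP j : t j \in G /\ decomp_perm (t j) i = j.
    by have /andP[? /eqP] := xchooseP (ex_t j).
  have sub_t w j : (w <= Vs i)%MS -> (w *m GLval (t j) <= Vs j)%MS.
    have [Gt tE] := tP j.
    by move=> wV; rewrite -{2}tE -decomp_permP // submxMr.
  pose u j := if j == j0 then a *m GLval (t j)
              else if j \in B then b *m GLval (t j) else 0.
  exists (\sum_j u j) => j _; rewrite /col component_sum => [|k]; last first.
    by rewrite /u; case: ifP => // _; [exact: sub_t | case: ifP; rewrite ?sub0mx ?sub_t].
  have [Gt _] := tP j.
  rewrite /u; case: (j == j0); first by rewrite GLval_mul_eq0 (negPf a0) orbM ?orb_a.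
  case: (j \in B); last by rewrite eqxx.
  by rewrite GLval_mul_eq0 (negPf b0) orbM // (negPf Nb).
have i_uniq j : j = i.
  have [g Gg <-] := decomp_perm_trans i j.
  exact: (astab_act (subsetP fixG _ Gg) (in_setT i)).
rewrite -[n in (n <= _)%N]card_ord -(cards1 i) -cardsT subset_leq_card //.
by apply/subsetP => j _; rewrite inE (i_uniq j).
Qed.

Lemma induced_perm_group_trans (i : 'I_n) :
  [transitive (decomp_perm_morphism @* G)%g, on [set: 'I_n] | 'P].
Proof.
apply/imsetP; exists i => //; apply/esym/setP => j; rewrite inE.
have [g Gg <-] := decomp_perm_trans i j.
by apply: mem_orbit; rewrite mem_morphim.
Qed.

End Decomposition.

Theorem theorem1p3 (p d : nat) (hp : prime p) (G : {group {'GL_d.+1['F_p]}})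
  (hirr : irreducible_lin G) (hexc : p_exceptional G) (himp : imprimitive_lin G)
  (hOp : Opprime_res p G = G)
  (n : nat) (Vs : 'I_n -> 'M['F_p]_d.+1) (hdec : permuted_decomposition G Vs)
  (i : 'I_n) :
  [transitive subspace_stab G (Vs i), on nonzero_vecs (Vs i) | 'MR (natrepr G)]
  /\ [primitive induced_perm_group G Vs, on [set: 'I_n] | 'P]
  /\ p_concealed p (induced_perm_group G Vs).
Proof.
split; first exact: subspace_stab_trans.
rewrite (induced_perm_groupE hdec); set rho := decomp_perm_morphism hdec.
have trK := induced_perm_group_trans hdec hirr i.
have copK := coprime_orbit_subset hdec hexc.
have genK : Opprime_res p (rho @* G)%g = (rho @* G)%g.
  exact: Opprime_res_morphim.
split; first exact: primitive_of_coprime_orbits copK.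
rewrite /p_concealed (introT forallP copK) andbT.
(* The induced group is generated by p-elements, so it only has to be nontrivial, which follows from
   transitivity on [n > 1] points. *)
apply: dvdn_card_Opprime_res => //; apply/eqP => K1.
have [n_gt1 _ _ _ _] := hdec.
have := atrans_dvd trK; rewrite -/rho K1 cards1 dvdn1 cardsT card_ord.
by move/eqP => n1; rewrite n1 in n_gt1.
Qed.
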